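(* Let $\Omega\subset\mathbb{R}^N$ ($N\geq1$) be an open and bounded $BV$ extension domain, and let $u\in L^1(\Omega)$ and $\varepsilon_0>0$. Then $$\lim_{\varepsilon\downarrow\varepsilon_0}\,(\varepsilon,1)\text{-}\mathrm{Var}\,u=(\varepsilon_0,1)\text{-}\mathrm{Var}\,u.$$
   Context: Functions are real-valued and elements of $L^1(\Omega)$ are identified when they agree Lebesgue-almost everywhere; $\|\cdot\|_1$ is the $L^1(\Omega)$-norm. When $N=1$, $\Omega$ is assumed to be an interval. Variation: for $u\in L^1(\Omega)$, $\mathrm{Var}\,u:=\sup\{\int_\Omega u\,\mathrm{div}\,\varphi\,dx \mid \varphi\in[C_c^1(\Omega)]^N,\ \|\varphi\|_\infty\le 1\}\in[0,\infty]$, and $BV(\Omega):=\{u\in L^1(\Omega)\mid \mathrm{Var}\,u<\infty\}$, a Banach space with norm $\|u\|_{BV}=\|u\|_1+\mathrm{Var}\,u$. $BV$ extension domain (Ambrosio–Fusco–Pallara, Definition 3.20): an open set $\Omega\subset\mathbb{R}^N$ with bounded boundary such that for every open set $A\supset\overline{\Omega}$ and every $m\ge1$ there is a linear continuous extension operator $T:[BV(\Omega)]^m\to[BV(\mathbb{R}^N)]^m$ (so $Tu=u$ a.e. in $\Omega$) with: $Tu=0$ a.e. in $\mathbb{R}^N\setminus A$ for all $u\in[BV(\Omega)]^m$; $|D(Tu)|(\partial\Omega)=0$ for all $u\in[BV(\Omega)]^m$; and for every $q\in[1,\infty]$ the restriction of $T$ to $[W^{1,q}(\Omega)]^m$ is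 a linear continuous map into $[W^{1,q}(\mathbb{R}^N)]^m$. $(\varepsilon,1)$-variation: for $u\in L^1(\Omega)$ and $\varepsilon>0$, $(\varepsilon,1)\text{-}\mathrm{Var}\,u:=\inf\{\mathrm{Var}\,v\mid v\in BV(\Omega),\ \|u-v\|_1\le\varepsilon\}$, with the convention that the infimum over the empty set is $\infty$. *)

(* Defs.v *)
From HB Require Import structures.
From mathcomp Require Import all_boot all_order all_algebra.
From mathcomp Require Import all_classical all_reals all_analysis.

Set Implicit Arguments.
Unset Strict Implicit.
Unset Printing Implicit Defensive.

Import Order.TTheory GRing.Theory Num.Theory.
Import numFieldNormedType.Exports.

Local Open Scope classical_set_scope.
Local Open Scope ring_scope.

(* R^N is ['rV[R]_N].  Its MathComp-Analysis norm [`|x|] is the sup norm: it is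
   only used for the topology and for boundedness; [enorm] below is the
   Euclidean norm. *)

HB.instance Definition _ (R : realType) (N : nat) :=
  @isMeasurable.Build default_measure_display 'rV[R]_N <<s @open 'rV[R]_N >>
    (@sigma_algebra0 _ setT _) (@sigma_algebraC _ _)
    (@sigma_algebra_bigcup _ setT _).

Section lebesgue_rV.
Context {R : realType}.

Lemma open_measurable_rV N (A : set 'rV[R]_N) : open A -> measurable A.
Proof. by move=> oA; exact: sub_sigma_algebra. Qed.

Lemma measurable_coord N (i : 'I_N) :
  measurable_fun [set: 'rV[R]_N] (fun x : 'rV[R]_N => x 0 i).
Proof.
apply: (@measurability _ _ 'rV[R]_N R _ _ (@measurable_realfun.RGenOpens.G R)).
  exact: measurable_realfun.RGenOpens.measurableE.
move=> _ [_ [a [b ->] <-]]; rewrite setTI; apply: open_measurable_rV.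
have /continuousP := @coord_continuous R 1 N 0 i.
by apply; exact: interval_open.
Qed.

Definition rat_box N (ab : 'rV[rat]_N * 'rV[rat]_N) : set 'rV[R]_N :=
  [set x | forall i, `]ratr (ab.1 0 i), ratr (ab.2 0 i)[%classic (x 0 i)].

Lemma open_rat_boxes N (A : set 'rV[R]_N) : open A ->
  A = \bigcup_(ab in [set ab | rat_box ab `<=` A]) rat_box ab.
Proof.
move=> oA; apply/seteqP; split=> [x Ax|x [ab /= sA Bx]]; last exact: sA.
have /nbhs_ballP[e /= e0 eA] : nbhs x A by exact: open_nbhs_nbhs.
have ha i : exists q : rat, x 0 i - e < ratr q < x 0 i.
  have /rat_in_itvoo[q qe] : x 0 i - e < x 0 i by rewrite ltrBlDr ltrDl.
  by exists q; move: qe; rewrite inE.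
have hb i : exists q : rat, x 0 i < ratr q < x 0 i + e.
  have /rat_in_itvoo[q qe] : x 0 i < x 0 i + e by rewrite ltrDl.
  by exists q; move: qe; rewrite inE.
have [a aP] := choice ha; have [b bP] := choice hb.
exists (\row_i a i, \row_i b i) => /= [y yab|i]; last first.
  by rewrite /= !mxE in_itv/=; have /andP[_ ->] := aP i; have /andP[-> _] := bP i.
apply: eA; split=> // i j; rewrite (ord1 i).
have := yab j; rewrite /= !mxE in_itv/= => /andP[ay yb].
have /andP[ea _] := aP j; have /andP[_ be] := bP j.
rewrite /ball/= distrC ltr_distl.
by rewrite (lt_trans ea ay) (lt_trans yb be).
Qed.

Lemma measurable_fun_rV d (T : measurableType d) N (f : T -> 'rV[R]_N) :
  (forall i, measurable_fun setT (fun t => f t 0 i)) ->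
  measurable_fun setT f.
Proof.
move=> mf; apply: (@measurability _ _ _ _ _ f (@open 'rV[R]_N)) => //.
move=> _ [A oA <-]; rewrite setTI (open_rat_boxes oA) preimage_bigcup.
rewrite bigcup_mkcond; apply: countable_bigcupT_measurable.
  exact: countableP.
move=> ab; case: ifPn => // _.
rewrite (_ : _ @^-1` _ = \bigcap_(i in [set: 'I_N])
    (setT `&` (fun t => f t 0 i) @^-1` `]ratr (ab.1 0 i), ratr (ab.2 0 i)[%classic)).
  apply: fin_bigcap_measurable => [|i _]; first exact: finite_finset.
  by apply: mf => //; exact: measurable_itv.
apply/seteqP; split=> [t h i _|t h i]; first by split=> //; exact: h.
by have [] := h i I.
Qed.

Definition cons_rV N (p : measurableTypeR R * 'rV[R]_N) : 'rV[R]_N.+1 :=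
  row_mx (const_mx p.1 : 'rV_1) p.2.

Definition uncons_rV N (x : 'rV[R]_N.+1) : measurableTypeR R * 'rV[R]_N :=
  (lsubmx (x : 'rV_(1 + N)) 0 0, rsubmx (x : 'rV_(1 + N))).

Lemma cons_rVK N : cancel (@cons_rV N) (@uncons_rV N).
Proof.
by move=> [a x]; rewrite /uncons_rV /cons_rV row_mxKl row_mxKr mxE.
Qed.

Lemma measurable_cons_rV N : measurable_fun setT (@cons_rV N).
Proof.
apply: measurable_fun_rV => i; rewrite /cons_rV.
have [j ij|j ij] := splitP (i : 'I_(1 + N)).
  rewrite (_ : (fun _ => _) = fst) //; apply/funext => p.
  have -> : i = lshift N j by exact/val_inj.
  by rewrite (row_mxEl (const_mx p.1 : 'rV_1)) mxE.
rewrite (_ : (fun _ => _) =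
    (fun x : 'rV[R]_N => x 0 j) \o snd).
  by apply: measurableT_comp => //; exact: measurable_coord.
apply/funext => p; have -> : i = rshift 1 j by exact/val_inj.
by rewrite (row_mxEr (const_mx p.1 : 'rV_1)).
Qed.

Lemma measurable_uncons_rV N : measurable_fun setT (@uncons_rV N).
Proof.
apply: measurable_fun_pair.
  under eq_fun do rewrite mxE; exact: measurable_coord.
apply: measurable_fun_rV => i; under eq_fun do rewrite mxE.
exact: measurable_coord.
Qed.

Section prepend.
Variables (N : nat) (mu : {sigma_finite_measure set 'rV[R]_N -> \bar R}).

Definition lebesgue_prod_rV : set 'rV[R]_N.+1 -> \bar R :=
  pushforward (lebesgue_measure \x mu)%E (@cons_rV N).

Let lebesgue_prod_rV0 : lebesgue_prod_rV set0 = 0%E.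
Proof. by apply: measure0; exact: measurable_cons_rV. Qed.

Let lebesgue_prod_rV_ge0 A : (0 <= lebesgue_prod_rV A)%E.
Proof. by apply: measure_ge0; exact: measurable_cons_rV. Qed.

Let lebesgue_prod_rV_sigma_additive : semi_sigma_additive lebesgue_prod_rV.
Proof.
by apply: measure_semi_sigma_additive; exact: measurable_cons_rV.
Qed.

HB.instance Definition _ := isMeasure.Build _ _ _ lebesgue_prod_rV
  lebesgue_prod_rV0 lebesgue_prod_rV_ge0 lebesgue_prod_rV_sigma_additive.

Let lebesgue_prod_rV_sigma_finite : sigma_finite setT lebesgue_prod_rV.
Proof.
have /sigma_finiteP[F [TF ndF Foo]] := sigma_finiteT (@lebesgue_measure R).
have /sigma_finiteP[G [TG ndG Goo]] := sigma_finiteT mu.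
exists (fun k => @uncons_rV N @^-1` (F k `*` G k)).
  apply/esym; rewrite -subTset => x _.
  have [i _ Fi] : (\bigcup_i F i) (uncons_rV x).1 by rewrite -TF.
  have [j _ Gj] : (\bigcup_i G i) (uncons_rV x).2 by rewrite -TG.
  exists (maxn i j) => //; split.
  - exact: (subsetPset _ _ (ndF _ _ (leq_maxl i j))).
  - exact: (subsetPset _ _ (ndG _ _ (leq_maxr i j))).
move=> k; have [mF Fk] := Foo k; have [mG Gk] := Goo k; split.
  rewrite -[X in measurable X]setTI.
  by apply: measurable_uncons_rV => //; exact: measurableX.
rewrite /lebesgue_prod_rV /pushforward -comp_preimage.
rewrite (_ : _ \o _ = id); last by apply/funext => p; exact: cons_rVK.
by rewrite preimage_id product_measure1E// lte_mul_pinfty// ge0_fin_numE.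
Qed.

HB.instance Definition _ := Measure_isSigmaFinite.Build _ _ _ lebesgue_prod_rV
  lebesgue_prod_rV_sigma_finite.
End prepend.

Fixpoint lebesgue_rV (N : nat) : {sigma_finite_measure set 'rV[R]_N -> \bar R} :=
  match N with
  | 0%N => \d_(0 : 'rV[R]_0)
  | N'.+1 => lebesgue_prod_rV (lebesgue_rV N')
  end.
End lebesgue_rV.

Definition enorm (R : realType) m n (A : 'M[R]_(m, n)) : R :=
  Num.sqrt (\sum_i \sum_j A i j ^+ 2).

Definition boundary (T : topologicalType) (A : set T) : set T :=
  closure A `\` A°.

Section test_functions.
Context {R : realType} (N : nat).
Implicit Types (f : 'rV[R]_N -> R) (Omega : set 'rV[R]_N).

Definition partial (i : 'I_N) f (x : 'rV[R]_N) : R := 'D_(delta_mx 0 i) f x.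

Fixpoint class_C (k : nat) f : Prop :=
  match k with
  | 0%N => continuous f
  | k'.+1 => (forall x, differentiable f x) /\
             (forall i, class_C k' (partial i f))
  end.

Definition class_Coo f : Prop := forall k, class_C k f.

(* Compactly supported functions on Omega are represented by their extension
   by 0 to R^N. *)
Definition compact_support (V : nmodType) Omega (f : 'rV[R]_N -> V) : Prop :=
  compact (closure [set x | f x != 0]) /\
  closure [set x | f x != 0] `<=` Omega.

Definition component n (u : 'rV[R]_N -> 'rV[R]_n) (i : 'I_n) : 'rV[R]_N -> R :=
  fun x => u x 0 i.

Definition divergence (phi : 'rV[R]_N -> 'rV[R]_N) (x : 'rV[R]_N) : R :=
  \sum_(i < N) partial i (component phi i) x.

End test_functions.

Local Open Scope ereal_scope.

Section function_spaces.
Context {R : realType} (N : nat).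
Implicit Types (u v : 'rV[R]_N -> R) (Omega : set 'rV[R]_N) (q : \bar R).

(* [u \_ Omega] is u on Omega and 0 (the default point of R) elsewhere. *)
Definition norm_L Omega q u : \bar R :=
  'N[lebesgue_rV N]_q [EFin \o (u \_ Omega)].

(* Elements of L^q(Omega) are represented by functions on R^N whose values
   outside Omega are irrelevant, and are never compared by equality. *)
Definition in_L Omega q u : Prop :=
  measurable_fun Omega u /\ norm_L Omega q u < +oo.

Definition Var Omega u : \bar R :=
  ereal_sup [set \int[lebesgue_rV N]_(x in Omega) (u x * divergence phi x)%:E |
    phi in [set phi : 'rV[R]_N -> 'rV[R]_N |
      [/\ forall i, class_C 1 (component phi i),
          compact_support Omega phi &
          forall x, (enorm (phi x) <= 1)%R]]].

Definition BV Omega u : Prop := in_L Omega 1 u /\ Var Omega u < +oo.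

Definition norm_BV Omega u : \bar R := norm_L Omega 1 u + Var Omega u.

Definition eps_Var Omega (eps : R) u : \bar R :=
  ereal_inf [set Var Omega v |
    v in [set v | BV Omega v /\ norm_L Omega 1 (fun x => u x - v x)%R <= eps%:E]].

Definition weak_partial Omega (i : 'I_N) u v : Prop :=
  forall phi : 'rV[R]_N -> R, class_Coo phi -> compact_support Omega phi ->
  \int[lebesgue_rV N]_(x in Omega) (u x * partial i phi x)%:E =
  - \int[lebesgue_rV N]_(x in Omega) (v x * phi x)%:E.

Definition W1 Omega q u : Prop :=
  in_L Omega q u /\ forall i, exists v, in_L Omega q v /\ weak_partial Omega i u v.

(* A representative of the weak partial derivative, which is unique a.e. *)
Definition dweak Omega q (i : 'I_N) u : 'rV[R]_N -> R :=
  xget (cst 0%R) [set v | in_L Omega q v /\ weak_partial Omega i u v].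

Definition norm_W1 Omega q u : \bar R :=
  norm_L Omega q u + \sum_(i < N) norm_L Omega q (dweak Omega q i u).

End function_spaces.

Section derivative_measure.
Context {R : realType} (N m : nat).

Definition integral_charge (nu : {charge set 'rV[R]_N -> \bar R}) (P Q : set 'rV[R]_N)
    (nuPQ : hahn_decomposition nu P Q) (f : 'rV[R]_N -> R) : \bar R :=
  \int[jordan_pos nuPQ]_x (f x)%:E - \int[jordan_neg nuPQ]_x (f x)%:E.

(* [mu] is the m x N matrix-valued measure D u on R^N.  The integral does not
   depend on the Hahn decomposition used to write it. *)
Definition is_derivative_measure (u : 'rV[R]_N -> 'rV[R]_m)
    (mu : 'I_m -> 'I_N -> {charge set 'rV[R]_N -> \bar R}) : Prop :=
  forall a i (phi : 'rV[R]_N -> R),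
  class_Coo phi -> compact_support setT phi ->
  forall (P Q : set 'rV[R]_N) (nuPQ : hahn_decomposition (mu a i) P Q),
  \int[lebesgue_rV N]_x (component u a x * partial i phi x)%:E =
  - integral_charge nuPQ phi.

Definition total_variation (mu : 'I_m -> 'I_N -> {charge set 'rV[R]_N -> \bar R})
    (B : set 'rV[R]_N) : \bar R :=
  ereal_sup [set \sum_(h <oo) (enorm (\matrix_(a, i) fine (mu a i (E h))))%:E |
    E in [set E : nat -> set 'rV[R]_N |
      [/\ forall h, measurable (E h), trivIset setT E & \bigcup_h E h = B]]].

End derivative_measure.

Section BV_extension_domain.
Context {R : realType} (N : nat).
Implicit Types (Omega A : set 'rV[R]_N).

(* The product spaces [BV(Omega)]^m and [W^{1,q}(Omega)]^m carry the product
   topology, here given by the sum of the norms of the components. *)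
Definition BVm m Omega (u : 'rV[R]_N -> 'rV[R]_m) : Prop :=
  forall a, BV Omega (component u a).

Definition norm_BVm m Omega (u : 'rV[R]_N -> 'rV[R]_m) : \bar R :=
  \sum_(a < m) norm_BV Omega (component u a).

Definition W1m m Omega (q : \bar R) (u : 'rV[R]_N -> 'rV[R]_m) : Prop :=
  forall a, W1 Omega q (component u a).

Definition norm_W1m m Omega (q : \bar R) (u : 'rV[R]_N -> 'rV[R]_m) : \bar R :=
  \sum_(a < m) norm_W1 Omega q (component u a).

(* Since [T] acts on representatives, linearity is required almost everywhere;
   together with continuity it makes [T u] depend only on the class of [u]. *)
Definition is_BV_extension_operator m Omega A
    (T : ('rV[R]_N -> 'rV[R]_m) -> ('rV[R]_N -> 'rV[R]_m)) : Prop :=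
  [/\ (forall u, BVm Omega u -> BVm setT (T u)),
      (forall (k : R) u v, BVm Omega u -> BVm Omega v ->
        {ae lebesgue_rV N, forall x,
          T (fun y => k *: u y + v y)%R x = (k *: T u x + T v x)%R}),
      (exists C : R, forall u, BVm Omega u ->
        norm_BVm setT (T u) <= C%:E * norm_BVm Omega u) &
      (forall u, BVm Omega u ->
        {ae lebesgue_rV N, forall x, Omega x -> T u x = u x})] /\
  [/\ (forall u, BVm Omega u ->
        {ae lebesgue_rV N, forall x, ~ A x -> T u x = 0%R}),
      (forall u, BVm Omega u ->
        exists mu, is_derivative_measure (T u) mu /\
          total_variation mu (boundary Omega) = 0) &
      (forall q : \bar R, 1 <= q ->
        (forall u, BVm Omega u -> W1m Omega q u -> W1m setT q (T u)) /\
        exists C : R, forall u, BVm Omega u -> W1m Omega q u ->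
          norm_W1m setT q (T u) <= C%:E * norm_W1m Omega q u)].

Definition BV_extension_domain Omega : Prop :=
  [/\ open Omega, bounded_set (boundary Omega) &
      forall A m, open A -> closure Omega `<=` A -> (0 < m)%N ->
      exists T : ('rV[R]_N -> 'rV[R]_m) -> ('rV[R]_N -> 'rV[R]_m),
        is_BV_extension_operator Omega A T].

End BV_extension_domain.

(* Main.v *)
Require Import Defs.
From mathcomp Require Import all_boot all_order all_algebra.
From mathcomp Require Import all_classical all_reals all_analysis.
From mathcomp Require Import measurable_realfun ring lra.

(* The proof uses convexity instead of compactness in BV.  Var is sublinear, so
   eps |-> (eps,1)-Var u is convex and nonincreasing, with values in [0,oo].  It
   is finite on all of (0,oo) because BV(Omega) is dense in L^1(Omega): bounded
   Lipschitz functions have finite variation on a bounded set, and they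
   approximate indicators of open sets, hence of Borel sets by a Dynkin
   argument, hence all integrable functions.  A finite convex function is
   continuous at the interior point eps0 > 0. *)

Set Implicit Arguments.
Unset Strict Implicit.
Unset Printing Implicit Defensive.

Import Order.TTheory GRing.Theory Num.Theory.
Import numFieldNormedType.Exports HBSimple.

Local Open Scope classical_set_scope.
Local Open Scope ring_scope.

(** What convexity consumes is one competitor strictly to the left of [eps0]. If v lies within
    [eps0 / 2] of u and has variation c, then, writing A for the value at [eps0], every eps > eps0
    satisfies A - (eps - eps0) / (eps0 / 2) * c <= (eps,1)-Var u <= A, and the limit follows by
    squeezing. Producing v is the main labour. Bounded Lipschitz functions are convenient here
    because inf-convolution gives them by a formula, and because their variation can be bounded
    without differentiating them: the derivative of the test field is a limit of difference
    quotients, and a translation moves each quotient onto v, where the Lipschitz constant controls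
    it. This rests on translation invariance of [lebesgue_rV], which has to be extracted from its
    recursive construction. Cubes in the sup norm serve throughout as sets of finite measure that
    contain the supports. *)

Definition cube (R : realType) N (M : R) : set 'rV[R]_N :=
  [set x | forall i, `|x 0 i| <= M].
Arguments cube {R} N M.

(** * Lebesgue measure on R^N: translation invariance and finiteness on cubes *)

Section lebesgue_rV_facts.
Context {R : realType}.
Implicit Type N : nat.

Lemma measurable_shift (c : R) :
  @measurable_fun _ _ (measurableTypeR R) (measurableTypeR R) setT
    (fun x => x + c).
Proof. exact: (@measurable_funD _ (measurableTypeR R)). Qed.

(** Lebesgue measure is determined by its values on half-open intervals, and a translation carries
    such an interval to one of the same length. *)
Lemma lebesgue_measure_shift (c : R) (A : set (measurableTypeR R)) :
  measurable A ->
  lebesgue_measure ((fun x : measurableTypeR R => x + c) @^-1` A) =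
  lebesgue_measure A.
Proof.
move=> mA; have ms := measurable_shift c.
pose f := (fun x => x + c) : measurableTypeR R -> measurableTypeR R.
rewrite -[LHS]/(pushforward lebesgue_measure f A).
apply/esym/lebesgue_measure_unique => //= _ [[a b]] _ <-.
rewrite /pushforward (_ : _ @^-1` _ = `]a - c, b - c]%classic).
  by rewrite !lebesgue_measure_itv/= !lte_fin ltrD2r -!EFinB; case: ifP => // _;
    congr EFin; ring.
by apply/seteqP; split=> x; rewrite /= !in_itv/= ltrBlDr lerBrDr.
Qed.

Lemma measurable_shift_rV N (w : 'rV[R]_N) :
  measurable_fun setT (fun x : 'rV[R]_N => x + w).
Proof.
apply: measurable_fun_rV => i.
rewrite (_ : (fun _ => _) = (fun x : 'rV[R]_N => x 0 i + w 0 i)).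
  by apply: measurable_funD; [exact: measurable_coord|exact: measurable_cst].
by apply/funext => x; rewrite mxE.
Qed.

(** Induction on the dimension. After splitting off the first coordinate, the translation acts
    separately on the two factors ([tau]), so uniqueness of the product measure reduces the claim to
    rectangles. In dimension 0 there is a single point and the translation is the identity. *)
Lemma lebesgue_rV_shift N (w : 'rV[R]_N) (A : set 'rV[R]_N) :
  measurable A ->
  lebesgue_rV N ((fun x => x + w) @^-1` A) = lebesgue_rV N A.
Proof.
elim: N w A => [|N ih] w A mA.
  congr (_ _); apply/seteqP; split=> x;
  by rewrite /preimage/= (_ : x + w = x)//; apply/rowP; case.
pose w0 := (uncons_rV w).1; pose w' := (uncons_rV w).2.
pose tau (p : measurableTypeR R * 'rV[R]_N)  : measurableTypeR R * 'rV[R]_N :=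
  (p.1 + w0, p.2 + w').
have mtau : measurable_fun setT tau.
  apply: measurable_fun_pair => /=.
    exact: (measurableT_comp (measurable_shift w0)).
  by apply: (measurableT_comp (measurable_shift_rV w')).
have mB : measurable (@cons_rV R N @^-1` A).
  by rewrite -[X in measurable X]setTI; exact: measurable_cons_rV.
rewrite /= /lebesgue_prod_rV /pushforward -comp_preimage.
rewrite (_ : _ \o _ = @cons_rV R N \o tau); last first.
  apply/funext => p /=; rewrite /cons_rV /=.
  have -> : w = row_mx (const_mx w0 : 'rV_1) w'.
    rewrite -[LHS](@hsubmxK _ _ 1); apply: (f_equal2 (@row_mx _ 1 1 N)) => //.
    by apply/rowP => i; rewrite !ord1 /w0 /uncons_rV/= !mxE.
  apply: (etrans (@add_row_mx _ 1 1 N _ _ _ _)).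
  apply: (f_equal2 (@row_mx _ 1 1 N)) => //.
  by apply/rowP => i; rewrite !mxE.
rewrite comp_preimage.
rewrite -[LHS]/(pushforward (lebesgue_measure \x lebesgue_rV N)%E tau _).
apply/esym; apply: product_measure_unique => //= C D mC mD.
rewrite /= /pushforward (_ : _ @^-1` _ = 
  ((fun x : measurableTypeR R => x + w0) @^-1` C) `*`
  ((fun x => x + w') @^-1` D))//.
rewrite product_measure1E//.
- by congr (_ * _)%E; [exact: lebesgue_measure_shift|exact: ih].
- rewrite -[X in measurable X]setTI.
  exact: measurable_shift.
- rewrite -[X in measurable X]setTI.
  exact: measurable_shift_rV.
Qed.

Lemma measurable_cube N (M : R) : measurable (cube N M).
Proof.
rewrite (_ : cube N M = \bigcap_(i in [set: 'I_N])
   (setT `&` (fun x : 'rV[R]_N => x 0 i) @^-1` `[- M, M]%classic)).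
  apply: fin_bigcap_measurable => [|i _]; first exact: finite_finset.
  by apply: measurable_coord => //; exact: measurable_itv.
apply/seteqP; split=> x /= h i.
  by move=> _; split=> //=; rewrite in_itv/= -ler_norml.
by have [//|_ /=] := h i; rewrite in_itv/= -ler_norml.
Qed.

Lemma lebesgue_rV_cube_lty N (M : R) : (lebesgue_rV N (cube N M) < +oo)%E.
Proof.
elim: N => [|N ih] /=; first by rewrite diracE ltry.
have hM : (lebesgue_measure (`[(- M)%R, M]%classic : set R) < +oo)%E.
  by rewrite lebesgue_measure_itv/=; case: ifP => // _; rewrite -EFinB ltry.
rewrite /lebesgue_prod_rV /pushforward.
rewrite (_ : _ @^-1` _ = `[- M, M]%classic `*` cube N M).
  rewrite product_measure1E//; last exact: measurable_cube.
  rewrite lte_mul_pinfty//.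
  by rewrite ge0_fin_numE//; exact: hM.
apply/seteqP; split=> -[a x] /=; rewrite /cube/= in_itv/= -ler_norml.
  move=> h; split.
    have := h (lshift N 0 : 'I_(1 + N)).
    by rewrite /cons_rV (@row_mxEl _ 1 1 N) mxE.
  by move=> i; have := h (rshift 1 i); rewrite /cons_rV (@row_mxEr _ 1 1 N).
move=> [ha hx] i; rewrite /cons_rV.
have [j ij|j ij] := splitP (i : 'I_(1 + N)).
  have -> : i = lshift N j by exact/val_inj.
  by rewrite (@row_mxEl _ 1 1 N) mxE.
have -> : i = rshift 1 j by exact/val_inj.
by rewrite (@row_mxEr _ 1 1 N); exact: hx.
Qed.

Lemma normr_coord_le N (x : 'rV[R]_N) i : `|x 0 i| <= `|x|.
Proof.
rewrite [leRHS]/Num.norm /= mx_normrE.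
by apply/bigmax_geP; right; exists (0, i).
Qed.

Lemma bounded_sub_cube N (A : set 'rV[R]_N) : bounded_set A ->
  exists M, A `<=` cube N M.
Proof.
move=> [M [_ hM]]; exists (M + 1) => x /(hM (M + 1)).
rewrite ltrDl => /(_ ltr01) xM i; apply: le_trans xM; exact: normr_coord_le.
Qed.

End lebesgue_rV_facts.

(** * Partial derivatives as limits of difference quotients *)

Section partial_facts.
Context {R : realType} {N : nat}.
Implicit Types (f v : 'rV[R]_N -> R) (K : set 'rV[R]_N) (i : 'I_N).

Lemma continuous_measurable_rV f : continuous f -> measurable_fun setT f.
Proof.
move=> /continuousP cf.
apply: (@measurability _ _ 'rV[R]_N R _ _ (@RGenOpens.G R)).
  exact: RGenOpens.measurableE.
move=> _ [_ [a [b ->] <-]]; rewrite setTI; apply: open_measurable_rV.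
by apply: cf; exact: interval_open.
Qed.

Lemma partial_off_support K f i x : closed K ->
  (forall x, ~ K x -> f x = 0) -> ~ K x -> partial i f x = 0.
Proof.
move=> cK f0 Kx; rewrite /partial (@near_eq_derive _ _ _ _ (cst 0)).
- by rewrite derive_cst.
- have /open_nbhs_nbhs : open_nbhs x (~` K) by split => //; exact: closed_openC.
  by apply: filterS => y /f0.
Qed.

Lemma continuous_compact_supp_bounded K f : compact K -> continuous f ->
  (forall x, ~ K x -> f x = 0) -> exists M, forall x, `|f x| <= M.
Proof.
move=> cK cf f0; have /compact_bounded[M [_ hM]] : compact (f @` K).
  by apply: continuous_compact => //; exact: continuous_subspaceT.
exists (`|M| + 1) => x; have [Kx|/f0->] := pselect (K x).
  by apply: hM; [rewrite ltr_pwDr// ler_norm|exists x].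
by rewrite normr0 addr_ge0.
Qed.

Lemma partial_is_derive f i x (t : R) :
  differentiable f (x + t *: delta_mx 0 i) ->
  is_derive t 1 (fun t => f (x + t *: delta_mx 0 i))
    (partial i f (x + t *: delta_mx 0 i)).
Proof.
move=> df.
have E : (fun h : R => h^-1 *:
    (((fun t => f (x + t *: delta_mx 0 i)) \o shift t) (h *: 1) -
      f (x + t *: delta_mx 0 i))) =
  (fun h : R => h^-1 *: ((f \o shift (x + t *: delta_mx 0 i))
    (h *: delta_mx 0 i) - f (x + t *: delta_mx 0 i))).
  apply/funext => h /=; congr (_ *: (f _ - _)).
  by rewrite scalerDl [h *: 1]mulr1 addrCA.
split; first by rewrite /derivable E; exact: diff_derivable.
by rewrite /derive E.
Qed.

(** The mean value theorem along a coordinate line. It bounds the difference quotients uniformly in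
    the step, as dominated convergence will require. *)
Lemma partial_mean_value f i (M : R) : (forall x, differentiable f x) ->
  (forall x, `|partial i f x| <= M) ->
  forall x (h : R), 0 <= h -> `|f (x + h *: delta_mx 0 i) - f x| <= M * h.
Proof.
move=> df pM x h h0; pose g (t : R) : R := f (x + t *: delta_mx 0 i).
have dg (t : R) : is_derive t 1 g (partial i f (x + t *: delta_mx 0 i)).
  exact: partial_is_derive.
have [|c _] := @MVT_segment R g _ 0 h h0 (fun t _ => dg t).
  apply: continuous_subspaceT => t; apply: differentiable_continuous.
  by apply/derivable1_diffP; have [] := dg t.
rewrite /g scale0r addr0 subr0 => ->.
by rewrite normrM (ger0_norm h0) ler_wpM2r.
Qed.

(** The derivative is a limit along the punctured filter at 0; the steps 1/(n+1) avoid 0 and turn it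
    into the limit of a sequence, the form that dominated convergence accepts. *)
Lemma partial_cvg f i x : differentiable f x ->
  (fun n => n.+1%:R * (f (x + n.+1%:R^-1 *: delta_mx 0 i) - f x)) @ \oo -->
  partial i f x.
Proof.
move=> df; have cf : derivable f x (delta_mx 0 i) by exact: diff_derivable.
have h0 : (fun n => n.+1%:R^-1 : R) @ \oo --> 0^'.
  move=> A [e /= e0 eA].
  have := @cvg_harmonic R => /cvgrPdist_lt /(_ _ e0); apply: filterS => n hn.
  by apply: eA => //=; rewrite invr_neq0.
have := cvg_comp _ _ h0 cf.
apply: cvg_trans; apply: near_eq_cvg; apply: nearW => n /=.
by rewrite invrK [x + _]addrC.
Qed.

End partial_facts.

(** * Lipschitz functions integrated against partial derivatives *)

Section lipschitz_variation.
Context {R : realType} {N : nat}.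
Implicit Types (f v : 'rV[R]_N -> R) (D K : set 'rV[R]_N) (i : 'I_N).
Local Notation mu := (@lebesgue_rV R N).

(** The Lipschitz constant refers to the sup norm, in which a coordinate step h moves a point by at
    most |h|. The bound on values holds on all of R^N, so that translates of v obey it too. *)
Definition bounded_lipschitz v : Prop :=
  exists M L : R, [/\ 0 <= L, forall x, `|v x| <= M &
    forall x y, `|v x - v y| <= L * `|x - y|].

Lemma bounded_lipschitz_continuous v : bounded_lipschitz v -> continuous v.
Proof.
move=> [M [L [L0 _ vL]]] x.
apply/(@cvgrPdist_lt _ _ _ (nbhs x) (nbhs_filter x)) => e e0.
(* [L + 1] replaces [L], which may be 0. *)
have d0 : 0 < e / (L + 1) by rewrite divr_gt0// ltr_wpDl.
apply/nbhs_ballP; exists (e / (L + 1)) => //= y.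
rewrite mx_norm_ball => xy; apply: (le_lt_trans (vL _ _)).
apply: (@le_lt_trans _ _ ((L + 1) * `|x - y|)).
  by rewrite ler_wpM2r// lerDl.
by rewrite mulrC -ltr_pdivlMr// ltr_wpDl.
Qed.

Lemma integrable_bounded_support f D (M : R) :
  measurable D -> (mu D < +oo)%E -> measurable_fun setT f ->
  (forall x, `|f x| <= M) -> (forall x, ~ D x -> f x = 0) ->
  mu.-integrable setT (EFin \o f).
Proof.
move=> mD Doo mf fM f0; rewrite (_ : EFin \o f = (EFin \o f) \_ D).
  apply/(integrable_mkcond _ mD).1/measurable_bounded_integrable => //.
    exact: measurable_funTS.
  exists M; split; first exact: num_real.
  by move=> r Mr x _; rewrite /= (le_trans (fM x))// ltW.
apply/funext => x; rewrite patchE; case: ifPn => // /negP.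
by rewrite inE => /f0 /= ->.
Qed.

Lemma integral_shift_rV f (w : 'rV[R]_N) :
  measurable_fun setT f ->
  mu.-integrable setT (fun x : 'rV[R]_N => (f (x + w))%:E) ->
  (\int[mu]_x (f (x + w))%:E = \int[mu]_x (f x)%:E)%E.
Proof.
move=> mf fi.
have ms := measurable_shift_rV w.
transitivity (\int[pushforward mu (fun x => x + w)%R]_x (f x)%:E)%E; last first.
  by apply: eq_measure_integral => //= A mA _; exact: lebesgue_rV_shift.
by rewrite integral_pushforward ?preimage_setT//; exact/measurable_EFinP.
Qed.

Lemma normr_delta_mx_le1 i : `|delta_mx 0 i : 'rV[R]_N| <= 1.
Proof.
rewrite [leLHS]/Num.norm /= mx_normrE.
apply/bigmax_leP; split=> //= -[j k] _ /=.
by rewrite mxE; case: (_ && _); rewrite ?normr1 ?normr0.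
Qed.

(* Translation invariance moves the difference quotient from f onto v. *)
Lemma lipschitz_difference_quotient v f i (C M L h : R) :
  0 <= L -> (forall x, `|v x| <= M) ->
  (forall x y, `|v x - v y| <= L * `|x - y|) ->
  measurable_fun setT v -> measurable_fun setT f ->
  (forall x, `|f x| <= 1) -> (forall x, ~ cube N C x -> f x = 0) ->
  0 < h ->
  (`|\int[mu]_x (v x * (h^-1 * (f (x + h *: delta_mx 0 i) - f x)))%:E| <=
   L%:E * mu (cube N C))%E.
Proof.
move=> L0 vM vL mv mf f1 f0 h0; set e := delta_mx 0 i.
have mD := @measurable_cube R N C; have Doo := @lebesgue_rV_cube_lty R N C.
have mfw (w : 'rV[R]_N) : measurable_fun setT (fun x : 'rV[R]_N => f (x + w)).
  exact: (measurableT_comp mf (measurable_shift_rV w)).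
have mvw (w : 'rV[R]_N) : measurable_fun setT (fun x : 'rV[R]_N => v (x + w)).
  exact: (measurableT_comp mv (measurable_shift_rV w)).
have i1 : mu.-integrable setT (fun x : 'rV[R]_N => (v x * f (x + h *: e))%:E).
  apply: (@integrable_bounded_support _ (cube N (C + h)) (M * 1)).
  - exact: measurable_cube.
  - exact: lebesgue_rV_cube_lty.
  - exact: measurable_funM.
  - by move=> x; rewrite normrM ler_pM.
  - move=> x nx; rewrite f0 ?mulr0// => xh; apply: nx => j.
    rewrite -[x](addrK (h *: e)) mxE (le_trans (ler_normD _ _))// lerD//.
    rewrite mxE normrN (le_trans (normr_coord_le _ _))// normrZ (gtr0_norm h0).
    by rewrite ger_pMr// normr_delta_mx_le1.
have i2 : mu.-integrable setT (fun x : 'rV[R]_N => (v x * f x)%:E).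
  apply: (@integrable_bounded_support _ (cube N C) (M * 1)) => //.
  - exact: measurable_funM.
  - by move=> x; rewrite normrM ler_pM.
  - by move=> x /f0 ->; rewrite mulr0.
have i3 : mu.-integrable setT (fun x : 'rV[R]_N => (v (x - h *: e) * f x)%:E).
  apply: (@integrable_bounded_support _ (cube N C) (M * 1)) => //.
  - exact: measurable_funM.
  - by move=> x; rewrite normrM ler_pM.
  - by move=> x /f0 ->; rewrite mulr0.
have E : (\int[mu]_x (v x * (h^-1 * (f (x + h *: e) - f x)))%:E =
  \int[mu]_x (h^-1 * (v (x - h *: e) - v x) * f x)%:E)%E.
  transitivity (h^-1%:E * (\int[mu]_x (v x * f (x + h *: e))%:E -
      \int[mu]_x (v x * f x)%:E))%E.
    rewrite -integralB_EFin// -integralZl//; last exact: integrableB.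
    by apply: eq_integral => x _; rewrite -EFinB -EFinM; congr EFin; ring.
  have -> : (\int[mu]_x (v x * f (x + h *: e))%:E =
    \int[mu]_x (v (x - h *: e) * f x)%:E)%E.
    rewrite -(@integral_shift_rV (fun x => v (x - h *: e) * f x) (h *: e)).
    - by apply: eq_integral => x _; rewrite addrK.
    - exact: measurable_funM.
    - by under eq_fun do rewrite addrK.
  rewrite -integralB_EFin// -integralZl//; last exact: integrableB.
  by apply: eq_integral => x _; rewrite -EFinB -EFinM; congr EFin; ring.
rewrite E.
have mg : measurable_fun setT
    (fun x : 'rV[R]_N => h^-1 * (v (x - h *: e) - v x) * f x).
  apply: measurable_funM => //; apply: measurable_funM => //.
  exact: measurable_funB.
(* After the transfer the factor [f x] is unshifted, so the integrand vanishes off [cube N C]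
   itself; the bound thus involves no enlargement depending on [h]. *)
rewrite (_ : (fun x => _) =
    (fun x => (h^-1 * (v (x - h *: e) - v x) * f x)%:E) \_ (cube N C)).
  rewrite -integral_mkcond (le_trans (le_abse_integral _ _ _))//.
    by apply/measurable_EFinP; exact: measurable_funTS.
  apply: integral_le_bound => //.
    by apply/measurable_EFinP; exact: measurable_funTS.
  apply: aeW => x _; rewrite lee_fin normrM.
  rewrite -[leRHS]mulr1 ler_pM// normrM gtr0_norm ?invr_gt0//.
  rewrite ler_pdivrMl// (le_trans (vL _ _))// mulrC ler_wpM2r//.
  rewrite addrAC subrr sub0r normrN normrZ (gtr0_norm h0).
  by rewrite ger_pMr// normr_delta_mx_le1.
apply/funext => x; rewrite patchE; case: ifPn => // /negP.
by rewrite inE => /f0 ->; rewrite mulr0.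
Qed.

(** This replaces an integration by parts in which v would have to be differentiated. The estimate
    for difference quotients does not depend on the step, hence survives the limit, which dominated
    convergence identifies with the integral against [partial i f]. *)
Lemma lipschitz_integral_partial v f i K (C M L : R) :
  0 <= L -> (forall x, `|v x| <= M) ->
  (forall x y, `|v x - v y| <= L * `|x - y|) ->
  class_C 1 f -> (forall x, `|f x| <= 1) ->
  compact K -> K `<=` cube N C -> (forall x, ~ K x -> f x = 0) ->
  (`|\int[mu]_x (v x * partial i f x)%:E| <= L%:E * mu (cube N C))%E.
Proof.
move=> L0 vM vL [df cp] f1 cK KC f0.
have cf : continuous f by move=> x; exact: differentiable_continuous.
have mf := continuous_measurable_rV cf.
have mv : measurable_fun setT v.
  apply: continuous_measurable_rV.
  by apply: bounded_lipschitz_continuous; exists M, L.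
have fC x : ~ cube N C x -> f x = 0 by move=> nx; apply: f0 => /KC.
have clK : closed K by apply: compact_closed => //; exact: norm_hausdorff.
have p0 x : ~ K x -> partial i f x = 0 by exact: partial_off_support.
have [P pP] := continuous_compact_supp_bounded cK (cp i) p0.
have P0 : 0 <= P by rewrite (le_trans _ (pP 0)).
have M0 : 0 <= M by rewrite (le_trans _ (vM 0)).
(* The double inverse makes [F n] literally the integrand of [lipschitz_difference_quotient] with h
   = 1/(n+1). *)
pose F n (x : 'rV[R]_N) := (v x * (n.+1%:R^-1^-1 *
  (f (x + n.+1%:R^-1 *: delta_mx 0 i) - f x)))%:E.
pose G (x : 'rV[R]_N) := (v x * partial i f x)%:E.
(* The dominating function: |v| <= M, and the quotients are at most P in absolute value by the mean
   value theorem. Every step is at most 1, so enlarging the cube by 1 contains all their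
   supports. *)
pose g (x : 'rV[R]_N) := ((M * P) * \1_(cube N (C + 1)) x)%:E.
have mfw (w : 'rV[R]_N) : measurable_fun setT (fun x : 'rV[R]_N => f (x + w)).
  exact: (measurableT_comp mf (measurable_shift_rV w)).
have [_ _] : [/\ mu.-integrable setT G,
    [sequence \int[mu]_x `|F n x - G x|]_n @ \oo --> 0 &
    [sequence \int[mu]_x F n x]_n @ \oo --> \int[mu]_x G x]%E.
  apply: (@dominated_convergence _ _ _ mu setT measurableT F G g).
  - move=> n; apply/measurable_EFinP; apply: measurable_funM => //.
    by apply: measurable_funM => //; exact: measurable_funB.
  - apply/measurable_EFinP; apply: measurable_funM => //.
    exact: continuous_measurable_rV.
  - apply: aeW => x _; apply: cvg_EFin; first exact: nearW.
    apply: cvgM; first exact: cvg_cst.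
    have := @partial_cvg _ _ f i x (df x).
    by under eq_fun do rewrite -[X in X * _]invrK.
  - apply: (@integrable_bounded_support _ (cube N (C + 1)) (M * P)).
    + exact: measurable_cube.
    + exact: lebesgue_rV_cube_lty.
    + apply: measurable_funM => //; apply: measurable_indic.
      exact: measurable_cube.
    + move=> x; rewrite indicE; case: (_ \in _).
        by rewrite mulr1 ger0_norm// mulr_ge0.
      by rewrite mulr0 normr0 mulr_ge0.
    + by move=> x nx; rewrite indicE memNset// mulr0.
  - apply: aeW => x n _; rewrite /F /g lee_fin.
    have [xC|xC] := pselect (cube N (C + 1) x).
      rewrite indicE mem_set// mulr1 normrM ler_pM//.
      rewrite invrK normrM ger0_norm// -ler_pdivlMl//.
      by rewrite mulrC; apply: partial_mean_value.
    rewrite !fC ?subrr ?mulr0 ?normr0 ?mulr_ge0//.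
      by move=> xC'; apply: xC => j; rewrite (le_trans (xC' j))// lerDl.
    move=> xC'; apply: xC => j.
    rewrite -[x](addrK (n.+1%:R^-1 *: delta_mx 0 i)) mxE.
    rewrite (le_trans (ler_normD _ _))// lerD//.
    rewrite mxE normrN (le_trans (normr_coord_le _ _))// normrZ.
    rewrite mulr_ile1// ?normr_delta_mx_le1//.
    by rewrite ger0_norm// invf_le1// ler1n.
move=> /(cvg_abse) cvF; rewrite -(cvg_lim _ cvF)//.
apply: lime_le; first by apply/cvg_ex; eexists; exact: cvF.
apply: nearW => n; apply: (@lipschitz_difference_quotient v f i C M L) => //.
Qed.

End lipschitz_variation.

(** * Variation: sublinearity, and finiteness for Lipschitz functions *)

Section variation.
Context {R : realType} {N : nat}.
Implicit Types (u v w : 'rV[R]_N -> R) (Omega : set 'rV[R]_N).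
Local Notation mu := (@lebesgue_rV R N).

Lemma norm_L1E Omega u :
  (norm_L Omega 1 u = \int[mu]_(x in Omega) `|(u x)%:E|)%E.
Proof.
rewrite /norm_L Lnorm1 [RHS]integral_mkcond; apply: eq_integral => x _ /=.
by rewrite !patchE; case: ifPn => //= _; rewrite normr0.
Qed.

Lemma in_L1P Omega u : in_L Omega 1%E u <-> mu.-integrable Omega (EFin \o u).
Proof.
rewrite /in_L norm_L1E; split=> [[mu_u uoo]|/integrableP[mu_u uoo]].
  by apply/integrableP; split=> //; exact/measurable_EFinP.
by split=> //; exact/measurable_EFinP.
Qed.

Definition test_field Omega (phi : 'rV[R]_N -> 'rV[R]_N) : Prop :=
  [/\ forall i, class_C 1 (component phi i), compact_support Omega phi &
      forall x, enorm (phi x) <= 1].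

Lemma normr_coord_le_enorm (x : 'rV[R]_N) i : `|x 0 i| <= enorm x.
Proof.
rewrite /enorm big_ord_recl big_ord0 addr0 -sqrtr_sqr ler_wsqrtr//.
rewrite (bigD1 i)//= lerDl sumr_ge0// => j _; exact: sqr_ge0.
Qed.

Lemma component_off_support (phi : 'rV[R]_N -> 'rV[R]_N) i x :
  ~ closure [set x | phi x != 0] x -> component phi i x = 0.
Proof.
move=> nx; rewrite /component; have [->|px] := eqVneq (phi x) 0.
  by rewrite mxE.
by exfalso; apply: nx; exact: subset_closure.
Qed.

Lemma divergence_continuous Omega phi : test_field Omega phi ->
  continuous (divergence phi).
Proof.
move=> [pC _ _]; apply: continuous_big => [|i _]; first exact: add_continuous.
by have [_ /(_ i)] := pC i.
Qed.

Lemma partial_component_off_support (phi : 'rV[R]_N -> 'rV[R]_N) i x :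
  ~ closure [set x | phi x != 0] x -> partial i (component phi i) x = 0.
Proof.
apply: partial_off_support; first exact: closed_closure.
by move=> y; exact: component_off_support.
Qed.

Lemma divergence_off_support (phi : 'rV[R]_N -> 'rV[R]_N) x :
  ~ closure [set x | phi x != 0] x -> divergence phi x = 0.
Proof.
move=> nx; rewrite /divergence big1// => i _.
exact: partial_component_off_support.
Qed.

Lemma divergence_bounded Omega phi : test_field Omega phi ->
  exists M, forall x, `|divergence phi x| <= M.
Proof.
move=> tphi; have [_ [cK _] _] := tphi.
apply: (continuous_compact_supp_bounded cK).
  exact: divergence_continuous tphi.
by move=> x; exact: divergence_off_support.
Qed.

(** The divergence is continuous with compact support, hence bounded. Integrability is what makes
    the pairing with a fixed test field linear in u. *)
Lemma integrable_mul_divergence Omega u phi : measurable Omega ->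
  in_L Omega 1%E u -> test_field Omega phi ->
  mu.-integrable Omega (fun x => (u x * divergence phi x)%:E).
Proof.
move=> mO /in_L1P iu tphi.
apply: (@integrableMl _ _ _ _ _ mO _ (divergence phi) iu).
  apply: measurable_funTS; apply: continuous_measurable_rV.
  exact: divergence_continuous tphi.
have [M hM] := divergence_bounded tphi.
exists M; split; first exact: num_real.
by move=> r Mr x _; apply: (le_trans (hM x)); exact: ltW.
Qed.

Lemma Var_ge0 Omega u : (0 <= Var Omega u)%E.
Proof.
apply: ereal_sup_ubound; exists (cst 0); last first.
  rewrite (_ : (fun x => _) = cst 0%E) ?integral0//; apply/funext => x.
  rewrite /divergence big1 ?mulr0// => i _.
  rewrite /partial (_ : component _ i = cst 0) ?derive_cst//.
  by apply/funext => y; rewrite /component mxE.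
have c0 i : component (cst 0 : 'rV[R]_N -> 'rV[R]_N) i = cst 0.
  by apply/funext => y; rewrite /component mxE.
split=> [i||x].
- rewrite c0; split=> [x|j]; first exact: differentiable_cst.
  rewrite (_ : partial j _ = cst 0); first exact: cst_continuous.
  by apply/funext => x; rewrite /partial derive_cst.
- rewrite /compact_support (_ : mkset _ = set0).
    by rewrite closure0; split => //; exact: compact0.
  by apply/seteqP; split=> x //=; rewrite eqxx.
- rewrite /enorm big1 ?sqrtr0// => i _; rewrite big1// => j _.
  by rewrite mxE expr0n.
Qed.

(** Var is a supremum of functionals linear in the function, one for each test field. *)
Lemma Var_lin Omega u v (a b : R) : measurable Omega ->
  0 <= a -> 0 <= b -> in_L Omega 1%E u -> in_L Omega 1%E v ->
  (Var Omega (fun x => a * u x + b * v x)%R <=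
   a%:E * Var Omega u + b%:E * Var Omega v)%E.
Proof.
move=> mO a0 b0 iu iv; apply: ge_ereal_sup => _ [phi tphi <-].
have iud := integrable_mul_divergence mO iu tphi.
have ivd := integrable_mul_divergence mO iv tphi.
rewrite (_ : (\int[_]_(x in _) _ =
  a%:E * \int[mu]_(x in Omega) (u x * divergence phi x)%:E +
  b%:E * \int[mu]_(x in Omega) (v x * divergence phi x)%:E)%E).
  by apply: leeD; apply: lee_wpmul2l; rewrite ?lee_fin//;
    apply: ereal_sup_ubound; exists phi.
rewrite -!integralZl// -integralD//; [|exact: integrableZl|exact: integrableZl].
by apply: eq_integral => x _; rewrite -!EFinM -EFinD; congr EFin; ring.
Qed.

Lemma bounded_lipschitz_in_L1 Omega v : measurable Omega ->
  (mu Omega < +oo)%E -> bounded_lipschitz v -> in_L Omega 1%E v.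
Proof.
move=> mO Ooo bv; apply/in_L1P; apply: measurable_bounded_integrable => //.
  apply: measurable_funTS; apply: continuous_measurable_rV.
  exact: bounded_lipschitz_continuous.
have [M [_ [_ vM _]]] := bv; exists M; split; first exact: num_real.
by move=> r Mr x _; apply: (le_trans (vM x)); exact: ltW.
Qed.

(** Since [phi] is supported inside [Omega], the integral extends to the whole space, where
    translations are available. Each component of [phi] is bounded by its Euclidean norm, so each of
    the N terms of the divergence contributes at most L times the measure of the cube. *)
Lemma bounded_lipschitz_Var Omega (C : R) v : measurable Omega ->
  Omega `<=` cube N C -> bounded_lipschitz v -> (Var Omega v < +oo)%E.
Proof.
move=> mO OC bv; have [M [L [L0 vM vL]]] := bv.
have Coo := @lebesgue_rV_cube_lty R N C.
apply: (@le_lt_trans _ _ (\sum_(i < N) L%:E * mu (cube N C))%E); last first.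
  rewrite lte_sum_pinfty// => i _; rewrite lte_mul_pinfty//.
apply: ge_ereal_sup => _ [phi tphi <-].
have [pC [cK KO] p1] := tphi; set K := closure _ in cK KO.
have ip i : mu.-integrable setT
    (fun x : 'rV[R]_N => (v x * partial i (component phi i) x)%:E).
  have [P pP] : exists P, forall x, `|partial i (component phi i) x| <= P.
    apply: (continuous_compact_supp_bounded cK).
      by have [_ /(_ i)] := pC i.
    by move=> x; exact: partial_component_off_support.
  apply: (@integrable_bounded_support _ _ _ (cube N C) (M * P)) => //.
  - exact: measurable_cube.
  - apply: measurable_funM; apply: continuous_measurable_rV.
      exact: bounded_lipschitz_continuous.
    by have [_ /(_ i)] := pC i.
  - by move=> x; rewrite normrM ler_pM.
  - move=> x nx; rewrite partial_component_off_support ?mulr0//.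
    by move=> /KO/OC.
rewrite (_ : (\int[_]_(x in _) _ =
    \sum_(i < N) \int[mu]_x (v x * partial i (component phi i) x)%:E)%E).
  apply: lee_sum => i _; apply: (le_trans (lee_abs _)).
  apply: (@lipschitz_integral_partial _ _ _ _ _ K C M L) => //.
  - by move=> x; rewrite (le_trans (normr_coord_le_enorm _ _)).
  - by move=> x /KO/OC.
  - by move=> x; exact: component_off_support.
rewrite -integral_sum// [LHS]integral_mkcond; apply: eq_integral => x _.
rewrite sumEFin -mulr_sumr patchE; case: ifPn => // /negP.
rewrite inE => nx; rewrite [X in _ * X]divergence_off_support ?mulr0//.
by move=> /KO.
Qed.

End variation.

(** * Density of bounded Lipschitz functions in L^1 *)

Section lipschitz_dense.
Context {R : realType} {N : nat}.
Implicit Types (f g u v w : 'rV[R]_N -> R).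
Local Notation mu := (@lebesgue_rV R N).

Lemma bounded_lipschitz_cst (c : R) : bounded_lipschitz (fun _ : 'rV[R]_N => c).
Proof.
by exists `|c|, 0; split=> // x y; rewrite subrr normr0 mul0r.
Qed.

Lemma bounded_lipschitz_lin (a : R) v w :
  bounded_lipschitz v -> bounded_lipschitz w ->
  bounded_lipschitz (fun x => a * v x + w x).
Proof.
move=> [M1 [L1 [L10 v1 v2]]] [M2 [L2 [L20 w1 w2]]].
exists (`|a| * M1 + M2), (`|a| * L1 + L2); split=> [|x|x y].
- by rewrite addr_ge0// mulr_ge0.
- by rewrite (le_trans (ler_normD _ _))// lerD// normrM ler_wpM2l.
- rewrite (_ : _ - _ = a * (v x - v y) + (w x - w y)); last by ring.
  rewrite (le_trans (ler_normD _ _))// mulrDl lerD// normrM -mulrA.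
  by rewrite ler_wpM2l.
Qed.

Lemma bounded_lipschitz_cvg_indic_open (U : set 'rV[R]_N) : open U ->
  exists v : nat -> 'rV[R]_N -> R,
    [/\ forall n, bounded_lipschitz (v n), forall n x, `|v n x| <= 1 &
        forall x, v n x @[n --> \oo] --> (\1_U x : R)].
Proof.
move=> oU.
(* Inf-convolution of the indicator with n |.| gives an n-Lipschitz minorant. *)
pose E (n : nat) (x : 'rV[R]_N) : set R :=
  [set \1_U y + n%:R * `|x - y| | y in [set: 'rV[R]_N]].
pose v n x := inf (E n x).
have E0 n x : lbound (E n x) 0.
  by move=> _ [y _ <-]; rewrite addr_ge0// mulr_ge0.
have En n x : E n x !=set0 by exists (\1_U x + n%:R * `|x - x|), x.
have v_le n x y : v n x <= \1_U y + n%:R * `|x - y|.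
  by apply: ge_inf; [exists 0; exact: E0|exists y].
have v_ge0 n x : 0 <= v n x by apply: lb_le_inf => //; exact: E0.
have v_le1 n x : v n x <= \1_U x.
  by have := v_le n x x; rewrite subrr normr0 mulr0 addr0.
have v1 n x : `|v n x| <= 1.
  by rewrite ger0_norm// (le_trans (v_le1 n x)).
have vL n x y : v n x - v n y <= n%:R * `|x - y|.
  rewrite lerBlDr addrC -lerBlDr; apply: lb_le_inf => // _ [z _ <-].
  rewrite lerBlDr (le_trans (v_le n x z))// -addrA lerD2l -mulrDr ler_wpM2l//.
  by rewrite [leRHS]addrC ler_distD.
exists v; split=> [n|n x|x]; [|exact: v1|].
  exists 1, n%:R; split=> // x y.
  by rewrite ler_norml vL andbT lerNl opprB -normrN opprB vL.
have [Ux|Ux] := pselect (U x); last first.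
  have vx0 n : v n x = 0.
    apply/eqP; rewrite eq_le v_ge0 andbT (le_trans (v_le1 n x))//.
    by rewrite indicE memNset.
  rewrite indicE memNset//; under eq_fun do rewrite vx0; exact: cvg_cst.
have /nbhs_ballP[e /= e0 eU] : nbhs x U by exact: open_nbhs_nbhs.
rewrite indicE mem_set//.
(* The value is exactly 1 once n * e >= 1: points y of the ball have indicator 1, and points outside
   it pay at least n * e in the distance term. *)
apply: cvg_near_cst; near=> n.
apply/eqP; rewrite eq_le (le_trans (ler_norm _))//=.
apply: lb_le_inf => // _ [y _ <-].
have [xy|xy] := ltP `|x - y| e.
  rewrite indicE mem_set ?lerDl ?mulr_ge0//.
  by apply: eU; rewrite mx_norm_ball.
rewrite (@le_trans _ _ (n%:R * `|x - y|))// ?lerDr//.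
rewrite (@le_trans _ _ (n%:R * e))// ?ler_wpM2l//.
rewrite -ler_pdivrMr// mul1r.
by near: n; exact: nbhs_infty_ger.
Unshelve. all: by end_near. Qed.

Variable Omega : set 'rV[R]_N.
Hypothesis mO : measurable Omega.
Hypothesis Ooo : (mu Omega < +oo)%E.

Definition l1_dist f g : \bar R :=
  (\int[mu]_(x in Omega) `|(f x - g x)%:E|)%E.

Lemma l1_dist_triangle f g h : measurable_fun Omega f ->
  measurable_fun Omega g -> measurable_fun Omega h ->
  (l1_dist f h <= l1_dist f g + l1_dist g h)%E.
Proof.
move=> mf mg mh; rewrite /l1_dist -ge0_integralD//.
- apply: ge0_le_integral => //.
  + apply: measurableT_comp => //; apply/measurable_EFinP.
    exact: measurable_funB.
  + by apply: emeasurable_funD; apply: measurableT_comp => //;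
      apply/measurable_EFinP; exact: measurable_funB.
  + move=> x _; rewrite /= -EFinD lee_fin; exact: ler_distD.
- apply: measurableT_comp => //; apply/measurable_EFinP.
  exact: measurable_funB.
- apply: measurableT_comp => //; apply/measurable_EFinP.
  exact: measurable_funB.
Qed.

Lemma l1_dist_lin (a : R) f g f' g' : measurable_fun Omega f ->
  measurable_fun Omega g -> measurable_fun Omega f' ->
  measurable_fun Omega g' ->
  (l1_dist (fun x => a * f x + g x)%R (fun x => a * f' x + g' x)%R <=
   `|a|%:E * l1_dist f f' + l1_dist g g')%E.
Proof.
move=> mf mg mf' mg'.
have mB (h h' : 'rV[R]_N -> R) :
    measurable_fun Omega h -> measurable_fun Omega h' ->
    measurable_fun Omega (fun x => `|(h x - h' x)%:E|%E).
  move=> mh mh'; apply: measurableT_comp => //; apply/measurable_EFinP.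
  exact: measurable_funB.
have maf : measurable_fun Omega (fun x => `|a|%:E * `|(f x - f' x)%:E|)%E.
  by apply: measurable_funeM; exact: mB.
rewrite /l1_dist -ge0_integralZl//; [|exact: mB].
rewrite -ge0_integralD//; [|exact: mB].
apply: ge0_le_integral => //.
- apply: mB; apply: measurable_funD => //; exact: measurable_funM.
- by apply: emeasurable_funD => //; exact: mB.
- move=> x _; rewrite /= -EFinM -EFinD lee_fin -normrM.
  rewrite (_ : _ - _ = a * (f x - f' x) + (g x - g' x)); last by ring.
  exact: ler_normD.
Qed.

Lemma l1_dist_cvg_bounded (g : nat -> 'rV[R]_N -> R) f :
  (forall n, measurable_fun Omega (g n)) -> measurable_fun Omega f ->
  (forall n x, `|g n x| <= 1) -> (forall x, g n x @[n --> \oo] --> f x) ->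
  forall e : R, 0 < e -> exists n, (l1_dist f (g n) <= e%:E)%E.
Proof.
move=> mg mf g1 gf e e0.
have [_ cv _] : [/\ mu.-integrable Omega (EFin \o f),
    [sequence \int[mu]_(x in Omega) `|(g n x)%:E - (f x)%:E|]_n @ \oo --> 0 &
    [sequence \int[mu]_(x in Omega) (g n x)%:E]_n @ \oo -->
      \int[mu]_(x in Omega) (f x)%:E]%E.
  apply: (@dominated_convergence _ _ _ mu Omega mO
      (fun n x => (g n x)%:E) (EFin \o f) (cst 1%E)).
  - by move=> n; apply/measurable_EFinP.
  - exact/measurable_EFinP.
  - apply: aeW => x _; apply: cvg_EFin; first exact: nearW.
    exact: gf.
  - apply: (@measurable_bounded_integrable _ _ _ mu (cst 1) Omega mO Ooo) => //.
    exists 1; split=> // r r1 x _ /=; rewrite normr1; exact: ltW.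
  - by apply: aeW => x n _; rewrite lee_fin.
have : \forall n \near \oo,
    (\int[mu]_(x in Omega) `|(g n x)%:E - (f x)%:E| < e%:E)%E.
  by apply: (cv [set y | y < e%:E]%E); apply: open_ereal_lt'; rewrite lte_fin.
case=> n _ /(_ n (leqnn n)) /= h; exists n; apply: ltW; apply: le_lt_trans h.
rewrite le_eqVlt; apply/orP; left; apply/eqP.
by apply: eq_integral => x _; rewrite /= distrC.
Qed.

(** Membership in the L^1 closure of the bounded Lipschitz functions. Measurability is carried along
    because the triangle inequality for [l1_dist] needs it. *)
Definition lipschitz_approx f : Prop := measurable_fun Omega f /\
  forall e : R, 0 < e -> exists2 v, bounded_lipschitz v &
    (l1_dist f v <= e%:E)%E.

Lemma bounded_lipschitz_measurable v : bounded_lipschitz v ->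
  measurable_fun Omega v.
Proof.
move=> bv; apply: measurable_funTS; apply: continuous_measurable_rV.
exact: bounded_lipschitz_continuous.
Qed.

Lemma eq_lipschitz_approx f g : f =1 g ->
  lipschitz_approx f -> lipschitz_approx g.
Proof. by move=> /funext ->. Qed.

Lemma lipschitz_approx_self v : bounded_lipschitz v -> lipschitz_approx v.
Proof.
move=> bv; split; first exact: bounded_lipschitz_measurable.
move=> e e0; exists v => //; rewrite /l1_dist integral0_eq ?lee_fin ?ltW//.
by move=> x _; rewrite subrr /= normr0.
Qed.

Lemma lipschitz_approx_lin (a : R) f g :
  lipschitz_approx f -> lipschitz_approx g ->
  lipschitz_approx (fun x => a * f x + g x).
Proof.
move=> [mf af] [mg ag]; split.
  by apply: measurable_funD => //; exact: measurable_funM.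
(* Adding 1 keeps the divisor positive when a = 0. *)
move=> e e0; have a0 : 0 < `|a| + 1 by rewrite ltr_wpDl.
have [|v bv fv] := af (e / 2 / (`|a| + 1)); first by rewrite !divr_gt0.
have [|w bw gw] := ag (e / 2); first by rewrite divr_gt0.
exists (fun x => a * v x + w x); first exact: bounded_lipschitz_lin.
have mv := bounded_lipschitz_measurable bv.
have mw := bounded_lipschitz_measurable bw.
apply: (le_trans (l1_dist_lin a mf mg mv mw)).
rewrite [e in leRHS]splitr EFinD leeD//.
apply: (@le_trans _ _ (`|a|%:E * (e / 2 / (`|a| + 1))%:E)%E).
  by rewrite lee_wpmul2l// lee_fin.
rewrite -EFinM lee_fin mulrCA ler_piMr ?divr_ge0 ?ltW//.
by rewrite ltr_pdivrMr// mul1r ltrDl.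
Qed.

Lemma lipschitz_approx_closed f : measurable_fun Omega f ->
  (forall e : R, 0 < e -> exists2 g, lipschitz_approx g &
    (l1_dist f g <= e%:E)%E) -> lipschitz_approx f.
Proof.
move=> mf af; split=> // e e0.
have e2 : 0 < e / 2 by rewrite divr_gt0.
have [g [mg ag] fg] := af _ e2; have [v bv gv] := ag _ e2.
exists v => //; rewrite [e in leRHS]splitr EFinD.
rewrite (le_trans (l1_dist_triangle _ mg _))//; last exact: leeD.
exact: bounded_lipschitz_measurable.
Qed.

Lemma lipschitz_approx_lim (g : nat -> 'rV[R]_N -> R) f :
  measurable_fun Omega f -> (forall n, lipschitz_approx (g n)) ->
  (forall n x, `|g n x| <= 1) -> (forall x, g n x @[n --> \oo] --> f x) ->
  lipschitz_approx f.
Proof.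
move=> mf ag g1 gf; apply: lipschitz_approx_closed => // e e0.
have mg n : measurable_fun Omega (g n) by case: (ag n).
have [n gn] := l1_dist_cvg_bounded mg mf g1 gf e0.
by exists (g n).
Qed.

(** Open sets are stable under intersection and generate the measurable sets, so it remains to treat
    open sets, complements and countable disjoint unions. *)
Lemma lipschitz_approx_indic (A : set 'rV[R]_N) : measurable A ->
  lipschitz_approx (\1_A : 'rV[R]_N -> R).
Proof.
have mI B : measurable B -> measurable_fun Omega (\1_B : 'rV[R]_N -> R).
  by move=> mB; apply: measurable_funTS; exact: measurable_indic.
have I1 (B : set 'rV[R]_N) x : `|\1_B x : R| <= 1.
  by rewrite indicE; case: (x \in B); rewrite ?normr1 ?normr0.
move=> mA; pattern A.
apply: (@dynkin_induction _ 'rV[R]_N (@open 'rV[R]_N)) => //.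
- exact: openI.
- rewrite indicT; apply: lipschitz_approx_self; exact: bounded_lipschitz_cst.
- move=> U oU; have [v [bv v1 vU]] := bounded_lipschitz_cvg_indic_open oU.
  apply: (lipschitz_approx_lim _ _ v1 vU).
    by apply: mI; exact: open_measurable_rV.
  by move=> n; exact: lipschitz_approx_self.
(* The indicator of the complement is (-1) * 1_B + 1. *)
- move=> B mB aB; have := lipschitz_approx_lin (-1) aB
    (lipschitz_approx_self (bounded_lipschitz_cst 1)).
  apply: eq_lipschitz_approx => x.
  rewrite !indicE in_setC; case: (x \in B) => /=; ring.
(* Disjointness makes the indicator of the partial union [G n] a sum of indicators; these converge
   pointwise to that of the full union and are bounded by 1. *)
- move=> F mF tF aF; pose G n := \big[setU/set0]_(k < n) F k.
  apply: (@lipschitz_approx_lim (fun n => \1_(G n))).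
  + by apply: mI; exact: bigcupT_measurable.
  + elim=> [|n ih].
      rewrite /G big_ord0 indic0; apply: lipschitz_approx_self.
      exact: bounded_lipschitz_cst.
    have := lipschitz_approx_lin 1 ih (aF n).
    apply: eq_lipschitz_approx => x.
    rewrite mul1r /G big_ord_recr/= -/(G n) !indicE in_setU.
    have [xG|_] := boolP (x \in G n); last by rewrite add0r.
    rewrite memNset ?addr0// => Fx; move: xG; rewrite inE /G -bigcup_mkord.
    move=> [k /= kn Fk]; have := tF k n I I => h.
    suff kE : k = n by rewrite kE ltnn in kn.
    by apply: h; exists x.
  + by move=> n x; exact: I1.
  + move=> x; have [[k _ Fk]|nx] := pselect ((\bigcup_k F k) x).
      rewrite indicE mem_set; last by exists k.
      apply: cvg_near_cst; near=> n; rewrite indicE mem_set//.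
      rewrite /G -bigcup_mkord; exists k => //=.
      by near: n; exact: nbhs_infty_gt.
    rewrite indicE memNset//; apply: cvg_near_cst; apply: nearW => n.
    rewrite indicE memNset// /G -bigcup_mkord => -[k _ Fk].
    by apply: nx; exists k.
Unshelve. all: by end_near. Qed.

Lemma lipschitz_approx_sum (I : Type) (r : seq I) (c : I -> R)
    (F : I -> 'rV[R]_N -> R) :
  (forall i, lipschitz_approx (F i)) ->
  lipschitz_approx (fun x => \sum_(i <- r) c i * F i x).
Proof.
move=> aF; elim: r => [|i r ih].
  under eq_fun do rewrite big_nil.
  by apply: lipschitz_approx_self; exact: bounded_lipschitz_cst.
under eq_fun do rewrite big_cons.
exact: lipschitz_approx_lin.
Qed.

Lemma lipschitz_approx_integrable u : mu.-integrable Omega (EFin \o u) ->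
  lipschitz_approx u.
Proof.
move=> iu; have mu_u : measurable_fun Omega u.
  by apply/measurable_EFinP; exact: measurable_int iu.
apply: lipschitz_approx_closed => // e e0.
have [g [ig _ cg]] := approximation_sfun_integrable mO iu.
have : \forall n \near \oo,
    (\int[mu]_(z in Omega) `|(u z)%:E - (g n z)%:E| < e%:E)%E.
  by apply: (cg [set y | y < e%:E]%E); apply: open_ereal_lt'; rewrite lte_fin.
case=> n _ /(_ n (leqnn n)) /= h; exists (g n); last exact: ltW.
(* A simple function is the finite sum, over the values y of its range, of y times the indicator of
   the level set of y. *)
have := @lipschitz_approx_sum _ (finmap.enum_fset (fset_set (range (g n)))) id
  (fun y => \1_(g n @^-1` [set y])) (fun y => _).
move=> /(_ (fun y =>
  lipschitz_approx_indic (measurable_sfunP _ (measurable_set1 y)))).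
apply: eq_lipschitz_approx => x.
by rewrite [RHS]fimfunE fsbig_finite.
Qed.

End lipschitz_dense.

(** * Convexity and finiteness of the (eps,1)-variation *)

Section epsilon_variation.
Context {R : realType} {N : nat}.
Implicit Types (u v w : 'rV[R]_N -> R) (Omega : set 'rV[R]_N).
Local Notation mu := (@lebesgue_rV R N).

Lemma in_L1_lin Omega (a b : R) u v : measurable Omega ->
  in_L Omega 1%E u -> in_L Omega 1%E v ->
  in_L Omega 1%E (fun x => a * u x + b * v x).
Proof.
move=> mO /in_L1P iu /in_L1P iv; apply/in_L1P.
have := integrableD mO (integrableZl mO a iu) (integrableZl mO b iv).
by apply: eq_integrable.
Qed.

Lemma norm_L1_lin Omega (a b : R) u v : measurable Omega ->
  0 <= a -> 0 <= b -> measurable_fun Omega u -> measurable_fun Omega v ->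
  (norm_L Omega 1 (fun x => a * u x + b * v x)%R <=
   a%:E * norm_L Omega 1 u + b%:E * norm_L Omega 1 v)%E.
Proof.
move=> mO a0 b0 mfu mfv; rewrite !norm_L1E.
have mabs w : measurable_fun Omega w ->
    measurable_fun Omega (fun x => `|(w x)%:E|%E).
  by move=> mw; apply: measurableT_comp => //; exact/measurable_EFinP.
have mcabs (c : R) w : measurable_fun Omega w ->
    measurable_fun Omega (fun x => c%:E * `|(w x)%:E|)%E.
  by move=> mw; apply: measurable_funeM; exact: mabs.
rewrite -!ge0_integralZl//; [|exact: mabs|exact: mabs].
have cabs0 (c : R) w x : 0 <= c -> (0 <= c%:E * `|(w x)%:E|)%E.
  by move=> c0; rewrite mule_ge0// lee_fin.
rewrite -ge0_integralD//; last 4 first.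
- by move=> x _; exact: cabs0.
- exact: (mcabs a u).
- by move=> x _; exact: cabs0.
- exact: (mcabs b v).
apply: ge0_le_integral => //.
- apply: (mabs (fun x => a * u x + b * v x)).
  by apply: measurable_funD; apply: measurable_funM.
- by apply: emeasurable_funD; [exact: (mcabs a u)|exact: (mcabs b v)].
- move=> x _; rewrite /= -!EFinM -EFinD lee_fin.
  by rewrite (le_trans (ler_normD _ _))// !normrM (ger0_norm a0) (ger0_norm b0).
Qed.

(** The combination t v + (1 - t) w is a competitor at the averaged level, because its difference
    from u is the same combination of u - v and u - w. Naming the competitors, rather than taking
    infima on the right, lets v stay fixed while w varies. *)
Lemma eps_Var_le_convex Omega u v w (e1 e2 t : R) : measurable Omega ->
  in_L Omega 1%E u -> 0 <= t <= 1 ->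
  BV Omega v -> (norm_L Omega 1 (fun x => u x - v x)%R <= e1%:E)%E ->
  BV Omega w -> (norm_L Omega 1 (fun x => u x - w x)%R <= e2%:E)%E ->
  (eps_Var Omega (t * e1 + (1 - t) * e2)%R u <=
   t%:E * Var Omega v + (1 - t)%:E * Var Omega w)%E.
Proof.
move=> mO iu /andP[t0 t1] [iv Vv] uv [iw Vw] uw.
have t10 : 0 <= 1 - t by rewrite subr_ge0.
have Vle := Var_lin mO t0 t10 iv iw.
apply: (le_trans _ Vle); apply: ereal_inf_lbound; eexists; last reflexivity.
split.
  split; first exact: in_L1_lin.
  by apply: (le_lt_trans Vle); rewrite lte_add_pinfty// lte_mul_pinfty.
rewrite (_ : (fun x => _) =
    (fun x => t * (u x - v x) + (1 - t) * (u x - w x))); last first.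
  by apply/funext => x; ring.
have [mfu _] := iu; have [mfv _] := iv; have [mfw _] := iw.
have muv := measurable_funB mfu mfv; have muw := measurable_funB mfu mfw.
apply: (le_trans (norm_L1_lin mO t0 t10 muv muw)).
by rewrite [leRHS]EFinD !EFinM leeD// lee_wpmul2l// lee_fin.
Qed.

Lemma eps_Var_nonincreasing Omega u (e1 e2 : R) : e1 <= e2 ->
  (eps_Var Omega e2 u <= eps_Var Omega e1 u)%E.
Proof.
move=> e12; apply: le_ereal_inf_tmp => _ [v [bv uv] <-].
apply: ereal_inf_lbound; exists v => //; split=> //.
by rewrite (le_trans uv)// lee_fin.
Qed.

Lemma eps_Var_ge0 Omega u (e : R) : (0 <= eps_Var Omega e u)%E.
Proof. by apply: le_ereal_inf_tmp => _ [v _ <-]; exact: Var_ge0. Qed.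

(** This makes the set of competitors nonempty at every positive level, so the infimum is finite
    there. *)
Lemma BV_dense_L1 Omega u (e : R) : measurable Omega -> bounded_set Omega ->
  in_L Omega 1%E u -> 0 < e ->
  exists2 v, BV Omega v & (norm_L Omega 1 (fun x => u x - v x)%R <= e%:E)%E.
Proof.
move=> mO /bounded_sub_cube[C OC] /in_L1P iu e0.
have Ooo : (mu Omega < +oo)%E.
  rewrite (le_lt_trans _ (lebesgue_rV_cube_lty N C))// le_measure// inE//.
  exact: measurable_cube.
have [_ /(_ e e0)[v bv uv]] := lipschitz_approx_integrable mO Ooo iu.
exists v; last by rewrite norm_L1E.
split; first exact: bounded_lipschitz_in_L1.
exact: (bounded_lipschitz_Var mO OC).
Qed.

End epsilon_variation.

(** * Right continuity at [eps0] *)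

Theorem proposition3p15 (R : realType) (N : nat) (Omega : set 'rV[R]_N)
    (u : 'rV[R]_N -> R) (eps0 : R) (N_gt0 : (0 < N)%N)
    (Omega_open : open Omega) (Omega_bounded : bounded_set Omega)
    (Omega_interval : N = 1%N ->
      forall i : 'I_N, is_interval [set x 0 i | x in Omega])
    (Omega_ext : BV_extension_domain Omega)
    (u_L1 : in_L Omega 1%E u) (eps0_gt0 : 0 < eps0) :
  eps_Var Omega eps u @[eps --> eps0^'+] --> eps_Var Omega eps0 u.
Proof.
have mO : measurable Omega by exact: open_measurable_rV.
(* The level [eps0 / 2] is an arbitrary choice of point strictly between 0 and [eps0]; its
   competitor v gives the left end of the convexity estimate. *)
have e1_gt0 : 0 < eps0 / 2 by rewrite divr_gt0.
have [v bv uv] := BV_dense_L1 mO Omega_bounded u_L1 e1_gt0.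
have [iv Vv] := bv.
have Vfin : Var Omega v \is a fin_num by rewrite ge0_fin_numE ?Var_ge0.
have e1_lt : eps0 / 2 < eps0 by lra.
have Afin : eps_Var Omega eps0 u \is a fin_num.
  rewrite ge0_fin_numE ?eps_Var_ge0// (le_lt_trans _ Vv)//.
  apply: ereal_inf_lbound; exists v => //; split=> //.
  by rewrite (le_trans uv)// lee_fin ltW.
set A := fine (eps_Var Omega eps0 u); set c := fine (Var Omega v).
have c0 : 0 <= c by rewrite fine_ge0 ?Var_ge0.
rewrite -(fineK Afin) -/A.
apply: (@squeeze_cvge _ _ _ _
  (fun eps => (A - (eps - eps0) / (eps0 / 2) * c)%:E) _ (fun=> A%:E));
  last 2 first.
- apply: cvg_EFin; first exact: nearW.
  rewrite -[X in _ --> X](_ : A - (eps0 - eps0) / (eps0 / 2) * c = A);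
    last by rewrite subrr !mul0r subr0.
  apply: cvg_at_right_filter; apply: cvgB; first exact: cvg_cst.
  apply: cvgMl; apply: cvgMl; apply: cvgB; [exact: cvg_id|exact: cvg_cst].
- exact: cvg_cst.
near=> eps; have eps_gt : eps0 < eps by near: eps; exact: nbhs_right_gt.
apply/andP; split; last first.
  by rewrite fineK//; apply: eps_Var_nonincreasing; exact: ltW.
apply: le_ereal_inf_tmp => _ [w [bw uw] <-].
have d0 : 0 < eps - eps0 / 2 by rewrite subr_gt0 (lt_trans e1_lt).
(* The weight that writes [eps0] as t * (eps0 / 2) + (1 - t) * eps. It tends to 0 as eps decreases
   to [eps0]. *)
pose t := (eps - eps0) / (eps - eps0 / 2).
have t01 : 0 <= t <= 1.
  rewrite /t ler_pdivrMr// mul1r lerD2l lerN2 (ltW e1_lt) andbT.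
  by rewrite divr_ge0// ltW// subr_gt0.
have [t0 t1] := andP t01.
have := eps_Var_le_convex mO u_L1 t01 bv uv bw uw.
rewrite (_ : t * (eps0 / 2) + (1 - t) * eps = eps0); last first.
  by rewrite /t; field; rewrite gt_eqF//; lra.
rewrite -(fineK Afin) -/A -(fineK Vfin) -/c => h.
have Vw0 := Var_ge0 Omega w.
have h2 : (A%:E <= (t * c)%:E + Var Omega w)%E.
  rewrite (le_trans h)// EFinM leeD2l// -[leRHS]mul1e lee_wpmul2r//.
  by rewrite lee_fin lerBlDr lerDl.
rewrite EFinB leeBlDl//.
rewrite (le_trans h2)// leeD2r// lee_fin ler_wpM2r//.
(* Since eps > eps0, the denominator of [t] is at least [eps0 / 2]; replacing it by this constant
   makes the lower bound affine in eps. *)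
rewrite /t ler_wpM2l ?subr_ge0 ?(ltW eps_gt)// lef_pV2 ?posrE//; lra.
Unshelve. all: by end_near. Qed.
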